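(* For all lists of integers $c_1,c_2$ with $\mathit{Wf}\ c_1$ and $\mathit{Wf}\ c_2$, and for all integers $\ell_1,\ell_2$: if $\ell_1\in c_1$, $\ell_2\in c_2$, $\mathit{NoCompLit}\ \ell_1\ c_2$, $\mathit{NoCompLit}\ \ell_2\ c_1$ and $\ell_1\neq\ell_2$, then $\ell_1\in c_1\bowtie c_2$ and $\ell_2\in c_1\bowtie c_2$.
   Context: Literals are integers and clauses are finite lists of integers. Lists are written $x::xs$ (cons) and $\mathit{nil}$ (empty); $\mathit{rev}$ reverses a list, $\mathit{app}$ concatenates two lists, $\mathit{abs}$ is the absolute value, and $\in$ denotes list membership. The function $\mathit{auxunion}(c_1,c_2,acc)$ is defined recursively by: - if $c_1=\mathit{nil}$, return $\mathit{app}(\mathit{rev}\ acc,c_2)$; - else if $c_2=\mathit{nil}$, return $\mathit{app}(\mathit{rev}\ acc,c_1)$; - else, with $c_1=x::xs$ and $c_2=y::ys$: - if $\mathit{abs}\,x<\mathit{abs}\,y$, return $\mathit{auxunion}(xs,y::ys,x::acc)$; - else if $\mathit{abs}\,y<\mathit{abs}\,x$, return $\mathit{auxunion}(x::xs,ys,y::acc)$; - else if $x=y$, return $\mathit{auxunion}(xs,ys,x::acc)$; - else return $\mathit{auxunion}(xs,ys,x::y::acc)$. The function $\mathit{union}(c_1,c_2,acc)$ is defined recursively by: - if $c_1=\mathit{nil}$, return $\mathit{app}(\mathit{rev}\ acc,c_2)$; - else if $c_2=\mathit{nil}$, return $\mathit{app}(\mathit{rev}\ acc,c_1)$; - else, with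 $c_1=x::xs$ and $c_2=y::ys$: - if $x+y=0$, return $\mathit{auxunion}(xs,ys,acc)$; - else if $\mathit{abs}\,x<\mathit{abs}\,y$, return $\mathit{union}(xs,y::ys,x::acc)$; - else if $\mathit{abs}\,y<\mathit{abs}\,x$, return $\mathit{union}(x::xs,ys,y::acc)$; - else return $\mathit{union}(xs,ys,x::acc)$. The resolution function is $c_1\bowtie c_2:=\mathit{union}(c_1,c_2,\mathit{nil})$. $\mathit{Wf}\ c$ means the conjunction of three conditions: - $\mathit{NoCompPair}\ c$: there is no literal $x\in c$ with $-x\in c$; - $\mathit{NoDup}\ c$: $c$ has no duplicate elements; - $\mathit{sorted}\ c$: $c$ is sorted in ascending order of absolute value. $\mathit{NoCompLit}\ \ell\ c$ means that there is no literal $m\in c$ with $\ell+m=0$. *)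

(* Defs.v *)
From Stdlib Require Export ZArith List Sorted.
Export ListNotations.

Open Scope Z_scope.

(* The inner fixpoint handles the calls in which only the second clause
   shrinks; the accumulator varies in every call. *)
Fixpoint auxunion (c1 : list Z) : list Z -> list Z -> list Z :=
  fix auxunion_c1 (c2 acc : list Z) {struct c2} : list Z :=
    match c1, c2 with
    | [], _ => rev acc ++ c2
    | _, [] => rev acc ++ c1
    | x :: xs, y :: ys =>
        if Z.abs x <? Z.abs y then auxunion xs (y :: ys) (x :: acc)
        else if Z.abs y <? Z.abs x then auxunion_c1 ys (y :: acc)
        else if x =? y then auxunion xs ys (x :: acc)
        else auxunion xs ys (x :: y :: acc)
    end.

Fixpoint union (c1 : list Z) : list Z -> list Z -> list Z :=
  fix union_c1 (c2 acc : list Z) {struct c2} : list Z :=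
    match c1, c2 with
    | [], _ => rev acc ++ c2
    | _, [] => rev acc ++ c1
    | x :: xs, y :: ys =>
        if x + y =? 0 then auxunion xs ys acc
        else if Z.abs x <? Z.abs y then union xs (y :: ys) (x :: acc)
        else if Z.abs y <? Z.abs x then union_c1 ys (y :: acc)
        else union xs ys (x :: acc)
    end.

Definition resolution (c1 c2 : list Z) : list Z := union c1 c2 [].

(* In particular 0 does not occur in c, since - 0 = 0. *)
Definition NoCompPair (c : list Z) : Prop :=
  ~ exists x : Z, In x c /\ In (- x) c.

Definition sorted (c : list Z) : Prop :=
  Sorted (fun x y : Z => Z.abs x <= Z.abs y) c.

Definition Wf (c : list Z) : Prop :=
  NoCompPair c /\ NoDup c /\ sorted c.

Definition NoCompLit (l : Z) (c : list Z) : Prop :=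
  ~ exists m : Z, In m c /\ l + m = 0.

(* Main.v *)
Require Import Defs.
From Stdlib Require Import ZArith List Lia.

(** Resolution discards both heads only when they sum to zero. A literal with no complement in the
    other clause is never half of such a pair, so it reaches the result. [in_union] proves this with
    an invariant: the literal is in the accumulator, or in one remaining clause and uncomplemented
    in the other. After the cancellation, [in_auxunion] needs no such condition. *)

(** Each head removed goes to the accumulator; the only one not pushed is a second copy of an equal
    head. *)
Lemma in_auxunion (l : Z) (c1 c2 acc : list Z) :
  In l c1 \/ In l c2 \/ In l acc -> In l (auxunion c1 c2 acc).
Proof.
  revert c2 acc; induction c1 as [|x xs IHxs]; intros c2.
  { destruct c2; intros acc H; simpl in *; rewrite in_app_iff, <- in_rev;
      simpl; tauto. }
  (* Nested induction follows the nested fixpoint: [IHys] serves the call that keeps [x :: xs]. *)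
  induction c2 as [|y ys IHys]; intros acc H.
  { simpl in *; rewrite in_app_iff, <- in_rev; simpl; tauto. }
  cbn.
  destruct (Z.ltb_spec (Z.abs x) (Z.abs y)).
  { apply IHxs; simpl in *; tauto. }
  destruct (Z.ltb_spec (Z.abs y) (Z.abs x)).
  { apply IHys; simpl in *; tauto. }
  destruct (Z.eqb_spec x y) as [<-|]; apply IHxs; simpl in *; tauto.
Qed.

Lemma NoCompLit_cons (l x : Z) (c : list Z) :
  NoCompLit l (x :: c) <-> l + x <> 0 /\ NoCompLit l c.
Proof.
  unfold NoCompLit; split.
  - intros H; split.
    + intros E; apply H; exists x; simpl; auto.
    + intros [m [Hm E]]; apply H; exists m; simpl; auto.
  - intros [Hx H] [m [[<-|Hm] E]]; [tauto|]; apply H; exists m; auto.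
Qed.

(* A literal can only be lost as half of the pair [x], [y] with [x + y = 0],
   which [NoCompLit] excludes. *)
Lemma in_union (l : Z) (c1 c2 acc : list Z) :
  (In l c1 /\ NoCompLit l c2) \/ (In l c2 /\ NoCompLit l c1) \/ In l acc ->
  In l (union c1 c2 acc).
Proof.
  revert c2 acc; induction c1 as [|x xs IHxs]; intros c2.
  { destruct c2; intros acc H; simpl in *; rewrite in_app_iff, <- in_rev;
      simpl; tauto. }
  induction c2 as [|y ys IHys]; intros acc H.
  { simpl in *; rewrite in_app_iff, <- in_rev; simpl; tauto. }
  rewrite !NoCompLit_cons in H; cbn.
  destruct (Z.eqb_spec (x + y) 0).
  { apply in_auxunion; simpl in H.
    (* If [l] were a cancelled head, the other head would be its complement in the opposite
       clause. *)
    assert (x = l -> l + y = 0) by lia.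
    assert (y = l -> l + x = 0) by lia.
    tauto. }
  destruct (Z.ltb_spec (Z.abs x) (Z.abs y)).
  { apply IHxs; rewrite NoCompLit_cons; simpl in *; tauto. }
  destruct (Z.ltb_spec (Z.abs y) (Z.abs x)).
  { apply IHys; rewrite NoCompLit_cons; simpl in *; tauto. }
  (* Equal absolute values and a nonzero sum force equal heads, so pushing [x] alone loses
     nothing. *)
  assert (x = y) as <- by lia.
  apply IHxs; simpl in *; tauto.
Qed.

Theorem theorem3 :
  forall (c1 c2 : list Z), Wf c1 -> Wf c2 ->
  forall (l1 l2 : Z),
    In l1 c1 -> In l2 c2 ->
    NoCompLit l1 c2 -> NoCompLit l2 c1 ->
    l1 <> l2 ->
    In l1 (resolution c1 c2) /\ In l2 (resolution c1 c2).
Proof.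
  intros c1 c2 _ _ l1 l2 H1 H2 N1 N2 _.
  split; apply in_union; auto.
Qed.
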